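(* Let $(\mathcal{X},\|\cdot\|)$ and $(\mathcal{Y},\|\cdot\|_{\mathcal{Y}})$ be separable Banach spaces, let $(\Omega,\Sigma,\mu)$ and $(\Omega_0,\Sigma_0,\mu_0)$ be finite and positive measure spaces with product measure space $(\Omega_*,\Sigma_*,\mu_* )$, and let $r>0$. Let $K:\Omega_0\times\Omega\times\mathcal{X}\to\mathcal{Y}$ satisfy: (A) $K(\cdot,\cdot,x):\Omega_0\times\Omega\to\mathcal{Y}$ is $\mu_*$-measurable for every $x\in\mathcal{X}$, and $K(\cdot,\cdot,0)\in L_1(\Omega_*,\Sigma_*,\mu_*;\mathcal{Y})$; (B) there exists a function $\psi:\Omega_0\times\Omega\to[0,+\infty)$ such that $\psi(\xi,\cdot)\in L_\infty(\Omega,\Sigma,\mu;[0,\infty))$ for $\mu_0$-almost all $\xi\in\Omega_0$, the function $\varphi(\xi)=\|\psi(\xi,\cdot)\|_\infty$ belongs to $L_1(\Omega_0,\Sigma_0,\mu_0;[0,\infty))$, and for $\mu_*$-almost all $(\xi,s)\in\Omega_0\times\Omega$ the inequality $\|K(\xi,s,x_1)-K(\xi,s,x_2)\|_{\mathcal{Y}}\le\psi(\xi,s)\|x_1-x_2\|$ holds for every $x_1,x_2\in\mathcal{X}$. For $p>1$ let $\mathcal{F}_p(r)=\{F(x):x\in B_{\Omega,\mathcal{X},p}(r)\}$, where $$F(x)(\xi)=\int_\Omega K(\xi,s,x(s))\,\mu(ds)\quad\text{for }\mu_0\text{-almost all }\xi\in\Omega_0 .$$ Let $p_*>1$. Then $\mathcal{H}_1\left(\mathcal{F}_p(r),\mathcal{F}_{p_*}(r)\right)\to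 0$ as $p\to p_*$.
   Context: For $p\ge1$, $L_p(\Omega,\Sigma,\mu;\mathcal{X})$ is the Bochner space of (equivalence classes of) $\mu$-measurable functions $x:\Omega\to\mathcal{X}$ with $\|x\|_p=\left(\int_\Omega\|x(s)\|^p\mu(ds)\right)^{1/p}<+\infty$, and $B_{\Omega,\mathcal{X},p}(r)=\{x\in L_p(\Omega,\Sigma,\mu;\mathcal{X}):\|x\|_p\le r\}$. $L_\infty(\Omega,\Sigma,\mu;[0,\infty))$ is the space of $\mu$-measurable $v:\Omega\to[0,\infty)$ with finite essential supremum $\|v\|_\infty=\inf\{\rho>0:v(s)\le\rho\text{ for }\mu\text{-a.a. }s\in\Omega\}$. Under (A) and (B), $F(x)\in L_1(\Omega_0,\Sigma_0,\mu_0;\mathcal{Y})$ for every $x\in B_{\Omega,\mathcal{X},p}(r)$, so $\mathcal{F}_p(r)\subset L_1(\Omega_0,\Sigma_0,\mu_0;\mathcal{Y})$. For bounded sets $Y,W\subset L_1(\Omega_0,\Sigma_0,\mu_0;\mathcal{Y})$, $$\mathcal{H}_1(Y,W)=\max\left\{\sup_{y\in Y}d_1(y,W),\ \sup_{w\in W}d_1(w,Y)\right\},\qquad d_1(y,W)=\inf\{\|y-w\|_1:w\in W\}.$$ *)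

(* Defs.v *)
From HB Require Import structures.
From mathcomp Require Export all_boot all_order all_algebra.
From mathcomp Require Export all_classical all_reals all_analysis.

Set Implicit Arguments.
Unset Strict Implicit.
Unset Printing Implicit Defensive.

Export Order.TTheory GRing.Theory Num.Theory.
Export numFieldNormedType.Exports.

Local Open Scope classical_set_scope.
Local Open Scope ring_scope.

Definition separable (T : topologicalType) :=
  exists2 D : set T, countable D & dense D.

(* Elements of the spaces L_p below are functions rather than classes modulo
   a.e. equality; Bnorm, dist_L1 and Hausdorff_L1 do not depend on the representatives. *)
Section Bochner.
Context {R : realType} {d : measure_display} {T : measurableType d}
  {V : normedModType R}.

Definition is_simple (f : T -> V) :=
  finite_set (range f) /\ forall v, measurable (f @^-1` [set v]).

(* The limit is only required a.e., so that this notion is the same for a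
   measure and for its completion; functions a.e. equal to a mu-measurable one
   are mu-measurable. *)
Definition strongly_measurable (mu : {measure set T -> \bar R}) (f : T -> V) :=
  exists g : nat -> T -> V, (forall n, is_simple (g n)) /\
    {ae mu, forall s, g n s @[n --> \oo] --> f s}.

Definition simple_integral (mu : {finite_measure set T -> \bar R})
    (f : T -> V) : V :=
  \sum_(v \in range f) fine (mu (f @^-1` [set v])) *: v.

Definition is_Bochner_integral (mu : {finite_measure set T -> \bar R})
    (f : T -> V) (I : V) :=
  strongly_measurable mu f /\
  exists g : nat -> T -> V, [/\ forall n, is_simple (g n),
    (\int[mu]_s (`|f s - g n s|%:E))%E @[n --> \oo] --> 0%E &
    simple_integral mu (g n) @[n --> \oo] --> I].

(* 0 when f is not Bochner integrable *)
Definition Bochner_integral (mu : {finite_measure set T -> \bar R})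
    (f : T -> V) : V :=
  xget 0 [set I | is_Bochner_integral mu f I].

Definition Bnorm (mu : {measure set T -> \bar R}) (p : R) (f : T -> V)
    : \bar R :=
  Lnorm mu p%:E (fun s => `|f s|%:E).

Definition Lp (mu : {measure set T -> \bar R}) (p : R) : set (T -> V) :=
  [set f | strongly_measurable mu f /\ (Bnorm mu p f < +oo)%E].

Definition Lp_ball (mu : {measure set T -> \bar R}) (p r : R)
    : set (T -> V) :=
  [set f | Lp mu p f /\ (Bnorm mu p f <= r%:E)%E].

Definition dist_L1 (mu : {measure set T -> \bar R}) (y : T -> V)
    (W : set (T -> V)) : \bar R :=
  ereal_inf [set Bnorm mu 1 (fun s => y s - w s) | w in W].

Definition Hausdorff_L1 (mu : {measure set T -> \bar R}) (Y W : set (T -> V))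
    : \bar R :=
  maxe (ereal_sup [set dist_L1 mu y W | y in Y])
       (ereal_sup [set dist_L1 mu w Y | w in W]).

End Bochner.

Section Linfty.
Context {R : realType} {d : measure_display} {T : measurableType d}.

(* ||v||_oo for v >= 0; unlike ess_sup it is 0, not -oo, when
   mu = 0. *)
Definition norm_infty (mu : {measure set T -> \bar R}) (v : T -> R)
    : \bar R :=
  ereal_inf (EFin @`
    [set rho : R | 0 < rho /\ {ae mu, forall s, v s <= rho}]).

Definition Linfty_nonneg (mu : {measure set T -> \bar R})
    : set (T -> R) :=
  [set v | [/\ forall s, 0 <= v s,
               strongly_measurable mu (v : T -> R^o) &
               (norm_infty mu v < +oo)%E]].

End Linfty.

Section Urysohn.
Context {R : realType} {d0 d : measure_display}
  {Omega0 : measurableType d0} {Omega : measurableType d}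
  {X Y : normedModType R}.

Definition Urysohn (mu : {finite_measure set Omega -> \bar R})
    (K : Omega0 -> Omega -> X -> Y) (x : Omega -> X) : Omega0 -> Y :=
  fun xi => Bochner_integral mu (fun s => K xi s (x s)).

Definition Urysohn_image (mu : {finite_measure set Omega -> \bar R})
    (K : Omega0 -> Omega -> X -> Y) (p r : R) : set (Omega0 -> Y) :=
  [set Urysohn mu K x | x in Lp_ball mu p r].

End Urysohn.

(* Main.v *)
(** Since psi(xi, .) <= phi(xi) a.e., the Urysohn operator satisfies
    |F x - F y|_1 <= |phi|_1 |x - y|_1, so it suffices to compare the balls of
    L_p and L_q in the L_1 distance.  With u = |x| / r and a = p / q, the radial
    rescaling y = u^(a - 1) x has |y| = r u^a, hence maps the ball of radius r of
    L_p into that of L_q, and |x - y| = r |u - u^a| <= C |a - 1| (1 + u^p), where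
    the right-hand side has integral O(|a - 1|), uniformly over the ball.

    F x need not be measurable in xi, and the integral of a non-measurable
    nonnegative function is here a lower integral, which is not subadditive; the
    estimates are therefore proved for the upper integral. *)

From mathcomp Require Import finmap.
Require Import Defs.
From mathcomp Require Import measurable_realfun ring lra.

Set Implicit Arguments.
Unset Strict Implicit.
Unset Printing Implicit Defensive.

Local Open Scope classical_set_scope.
Local Open Scope ring_scope.

(** * Upper integrals *)

Section UpperIntegral.
Context {R : realType} {d : measure_display} {T : measurableType d}.
Variable mu : {measure set T -> \bar R}.
Implicit Types f g : T -> R.

(** The upper integral of [f] is bounded by exhibiting one measurable a.e. majorant. Nothing is
    asked of [f] itself, so the bounds add up and pass to a.e. smaller functions without any
    measurability. *)
Definition upper_integral_le f (c : R) :=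
  exists g : T -> \bar R, [/\ measurable_fun setT g, forall s, (0 <= g s)%E,
    {ae mu, forall s, ((f s)%:E <= g s)%E} & (\int[mu]_s g s <= c%:E)%E].

Lemma le_ge0_integral (f g : T -> \bar R) : (forall s, 0 <= f s)%E ->
  (forall s, f s <= g s)%E -> (\int[mu]_s f s <= \int[mu]_s g s)%E.
Proof.
move=> f0 fg; have g0 s : (0 <= g s)%E by exact: le_trans (fg s).
rewrite !ge0_integralTE//; apply: ereal_sup_le => _ /= [h hf <-].
by exists h => // s; exact: le_trans (fg s).
Qed.

Lemma ae_le_ge0_integral (f g : T -> \bar R) : (forall s, 0 <= f s)%E ->
  measurable_fun setT g -> (forall s, 0 <= g s)%E ->
  {ae mu, forall s, (f s <= g s)%E} -> (\int[mu]_s f s <= \int[mu]_s g s)%E.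
Proof.
move=> f0 mg g0 [N [mN N0 subN]].
(* Raising [g] to infinity on the null set makes the inequality hold everywhere and leaves the
   integral of the measurable [g] unchanged. *)
pose h s := if s \in N then +oo%E else g s.
have mh : measurable_fun setT h.
  apply: measurable_fun_ifT => //.
  apply: (measurable_fun_bool true).
  rewrite (_ : _ `&` _ = N)//; apply/seteqP; split => s /=.
    by move=> [_ /set_mem].
  by move=> Ns; rewrite mem_set.
have h0 s : (0 <= h s)%E by rewrite /h; case: ifP.
apply: (@le_trans _ _ (\int[mu]_s h s)%E).
  apply: le_ge0_integral => // s; rewrite /h.
  case: ifPn => [_|/negP sN]; first by rewrite leey.
  apply: contrapT => fg; apply: sN; rewrite inE; exact: subN.
rewrite le_eqVlt; apply/orP; left; apply/eqP.
apply: ge0_ae_eq_integral => //.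
exists N; split => // s /= /not_implyP[_ hg].
apply: contrapT => sN; apply: hg; rewrite /h; case: ifPn => //; rewrite inE//.
Qed.

Lemma upper_integral_leP f c : (forall s, 0 <= f s) -> upper_integral_le f c ->
  (\int[mu]_s (f s)%:E <= c%:E)%E.
Proof.
move=> f0 [g [mg g0 fg gc]]; apply: le_trans gc.
by apply: ae_le_ge0_integral => // s; rewrite lee_fin.
Qed.

Lemma upper_integral_le_ge0 f c : upper_integral_le f c -> 0 <= c.
Proof.
move=> [g [_ g0 _ gc]]; rewrite -lee_fin; apply: le_trans gc.
exact: integral_ge0.
Qed.

Lemma upper_integral_le_ae f g c : {ae mu, forall s, f s <= g s} ->
  upper_integral_le g c -> upper_integral_le f c.
Proof.
move=> fg [h [mh h0 gh hc]]; exists h; split => //.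
by apply: filterS2 fg gh => s fg gh; apply: le_trans gh; rewrite lee_fin.
Qed.

Lemma upper_integral_leS f g c : (forall s, f s <= g s) ->
  upper_integral_le g c -> upper_integral_le f c.
Proof. by move=> fg; apply: upper_integral_le_ae; exact: aeW. Qed.

Lemma upper_integral_leW f c e : c <= e ->
  upper_integral_le f c -> upper_integral_le f e.
Proof.
move=> ce [h [mh h0 gh hc]]; exists h; split => //.
by apply: le_trans hc _; rewrite lee_fin.
Qed.

Lemma upper_integral_leD f g c e : upper_integral_le f c ->
  upper_integral_le g e -> upper_integral_le (fun s => f s + g s) (c + e).
Proof.
move=> [h [mh h0 fh hc]] [k [mk k0 gk ke]].
exists (h \+ k)%E; split.
- exact: emeasurable_funD.
- by move=> s; apply: adde_ge0.
- by apply: filterS2 fh gk => s; rewrite EFinD; apply: leeD.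
- by rewrite ge0_integralD// EFinD leeD.
Qed.

Lemma upper_integral_leZ f c k : 0 <= k -> upper_integral_le f c ->
  upper_integral_le (fun s => k * f s) (k * c).
Proof.
move=> k0 [h [mh h0 fh hc]].
exists (fun s => k%:E * h s)%E; split.
- exact: measurable_funeM.
- by move=> s; apply: mule_ge0.
- by apply: filterS fh => s; rewrite EFinM; apply: lee_wpmul2l.
- by rewrite ge0_integralZl_EFin// EFinM lee_wpmul2l.
Qed.

Lemma measurable_upper_integral_le f c : (forall s, 0 <= f s) ->
  measurable_fun setT f -> (\int[mu]_s (f s)%:E <= c%:E)%E ->
  upper_integral_le f c.
Proof.
move=> f0 mf fc; exists (EFin \o f); split => //.
- exact/measurable_EFinP.
- exact: aeW.
Qed.

Lemma upper_integral_le0 : upper_integral_le (fun=> 0) 0.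
Proof. by apply: measurable_upper_integral_le => //; rewrite integral0. Qed.

End UpperIntegral.

(** * Simple and strongly measurable functions *)

Section Simple.
Context {R : realType} {d : measure_display} {T : measurableType d}.
Context {V : normedModType R}.
Implicit Types (f : T -> V).

Lemma is_simple_cst (v : V) : is_simple (fun _ : T => v).
Proof.
split.
  apply: (@sub_finite_set _ _ [set v]) => [x [s _ <-]//|]; exact: finite_set1.
by move=> w; rewrite preimage_cst; case: ifP.
Qed.

(** [A] may be any set, Borel or not: only finitely many fibres of [f] meet its preimage. *)
Lemma is_simple_preimage f (A : set V) : is_simple f -> measurable (f @^-1` A).
Proof.
move=> [fin mf].
rewrite (_ : f @^-1` A = \bigcup_(v in range f `&` A) f @^-1` [set v]).
  apply: fin_bigcup_measurable => //; exact: finite_setIl.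
apply/seteqP; split => s /=; last by move=> [v [_ Av] /= ->].
by move=> Afs; exists (f s) => //; split => //; exists s.
Qed.

Lemma measurable_simple_comp f (h : V -> R) : is_simple f ->
  measurable_fun setT (h \o f).
Proof.
move=> sf _ B mB; rewrite setTI comp_preimage; exact: is_simple_preimage.
Qed.

End Simple.

Section SimpleComp.
Context {R : realType} {d : measure_display} {T : measurableType d}.
Context {V W : normedModType R}.

(** Glues finitely many simple functions along the fibres of [f]; composition, pairing and the
    superposition [K xi s (h s)] are all instances of this pattern. *)
Lemma is_simple_dep_comp (f : T -> V) (k : V -> T -> W) : is_simple f ->
  (forall v, range f v -> is_simple (k v)) -> is_simple (fun s => k (f s) s).
Proof.
move=> sf sk; split.
  apply: (@sub_finite_set _ _ (\bigcup_(v in range f) range (k v))).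
    by move=> _ [s _ <-]; exists (f s); [exists s|exists s].
  apply: bigcup_finite; first by case: sf.
  by move=> v fv; case: (sk v fv).
move=> w; rewrite (_ : _ @^-1` _ =
  \bigcup_(v in range f) (f @^-1` [set v] `&` k v @^-1` [set w])).
  apply: fin_bigcup_measurable; first by case: sf.
  move=> v fv; apply: measurableI; first exact: is_simple_preimage.
  by apply: is_simple_preimage; exact: sk.
apply/seteqP; split => s /=.
  by move=> <-; exists (f s) => //; exists s.
by move=> [v _ [/= <-]].
Qed.

Lemma is_simple_comp (f : T -> V) (h : V -> W) : is_simple f -> is_simple (h \o f).
Proof.
move=> sf; apply: (is_simple_dep_comp (k := fun v _ => h v)) => // v _.
exact: is_simple_cst.
Qed.

End SimpleComp.

Section SimpleOps.
Context {R : realType} {d : measure_display} {T : measurableType d}.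
Context {V W Z : normedModType R}.

Lemma is_simple_comp2 (f : T -> V) (g : T -> W) (h : V -> W -> Z) :
  is_simple f -> is_simple g -> is_simple (fun s => h (f s) (g s)).
Proof.
move=> sf sg; apply: (is_simple_dep_comp (k := fun v s => h v (g s))) => // v _.
exact: (is_simple_comp (h v)).
Qed.

Lemma is_simple_if (b : T -> bool) (f g : T -> V) : measurable [set s | b s] ->
  is_simple f -> is_simple g -> is_simple (fun s => if b s then f s else g s).
Proof.
move=> mb sf sg; split.
  apply: (@sub_finite_set _ _ (range f `|` range g)).
    by move=> _ [s _ <-]; case: ifP => _; [left|right]; exists s.
  by rewrite finite_setU; split; [case: sf|case: sg].
move=> v; rewrite (_ : _ @^-1` _ =
  ([set s | b s] `&` f @^-1` [set v]) `|` (~` [set s | b s] `&` g @^-1` [set v])).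
  apply: measurableU; apply: measurableI.
  - exact: mb.
  - exact: is_simple_preimage.
  - exact: measurableC.
  - exact: is_simple_preimage.
apply/seteqP; split => s /=.
  by case: ifPn => bs <-; [left|right]; split => //; exact/negP.
by move=> [[-> //]|[/negP/negbTE ->]].
Qed.

End SimpleOps.

Section StronglyMeasurable.
Context {R : realType} {d : measure_display} {T : measurableType d}.
Variable mu : {measure set T -> \bar R}.
Context {V W : normedModType R}.

Lemma is_simple_strongly_measurable (f : T -> V) :
  is_simple f -> strongly_measurable mu f.
Proof. by move=> sf; exists (fun=> f); split => //; apply: aeW => s; exact: cvg_cst. Qed.

Lemma strongly_measurable_comp (f : T -> V) (h : V -> W) : continuous h ->
  strongly_measurable mu f -> strongly_measurable mu (h \o f).
Proof.
move=> ch [g [sg gf]]; exists (fun n => h \o g n); split.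
  by move=> n; exact: is_simple_comp.
by apply: filterS gf => s gf; apply: continuous_cvg => //; exact: ch.
Qed.

Lemma strongly_measurableB (f g : T -> V) : strongly_measurable mu f ->
  strongly_measurable mu g -> strongly_measurable mu (fun s => f s - g s).
Proof.
move=> [f_ [sf ff]] [g_ [sg gg]]; exists (fun n s => f_ n s - g_ n s); split.
  by move=> n; apply: (is_simple_comp2 (fun v w => v - w)).
by apply: filterS2 ff gg => s; exact: cvgB.
Qed.

(* The approximants are set to zero on the null set where they do not converge. *)
Lemma strongly_measurable_everywhere (f : T -> V) : strongly_measurable mu f ->
  exists (f' : T -> V) (g : nat -> T -> V), [/\ forall n, is_simple (g n),
    forall s, g n s @[n --> \oo] --> f' s & {ae mu, forall s, f s = f' s}].
Proof.
move=> [g [sg [N [mN N0 gN]]]].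
exists (fun s => if s \in N then 0 else f s), (fun n s => if s \in N then 0 else g n s).
split.
- move=> n; apply: is_simple_if => //; last exact: is_simple_cst.
  by rewrite (_ : [set s | _] = N)//; apply/seteqP; split => s /=; rewrite inE.
- move=> s; case: ifPn => [_|/negP sN]; first exact: cvg_cst.
  by apply: contrapT => gs; apply: sN; rewrite inE; exact: gN.
- exists N; split => // s /=; case: ifPn => //; first by rewrite inE.
Qed.

Lemma measurable_limit_comp (f : T -> V) (g : nat -> T -> V) (h : V -> R) :
  continuous h -> (forall n, is_simple (g n)) ->
  (forall s, g n s @[n --> \oo] --> f s) -> measurable_fun setT (h \o f).
Proof.
move=> ch sg gf; apply: (@measurable_fun_cvg _ _ _ _ (fun n => h \o g n)) => //.
  by move=> n; exact: measurable_simple_comp.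
by move=> s _; apply: (@continuous_cvg _ _ _ _ _ _ h) => //; exact: ch.
Qed.

(** This is the passage from the lower to the upper integral: up to a null set [f] is an everywhere
    limit of simple functions, so that [h \o f] has a measurable version. *)
Lemma strongly_measurable_upper_integral_le (f : T -> V) (h : V -> R) c :
  continuous h -> (forall v, 0 <= h v) -> strongly_measurable mu f ->
  (\int[mu]_s (h (f s))%:E <= c%:E)%E -> upper_integral_le mu (h \o f) c.
Proof.
move=> ch h0 /strongly_measurable_everywhere[f' [g [sg gf ff']]] hc.
have mf' := measurable_limit_comp ch sg gf.
apply: (@upper_integral_le_ae _ _ _ _ _ (h \o f')).
  by apply: filterS ff' => s /= ->.
apply: measurable_upper_integral_le => //; first by move=> s /=.
apply: le_trans hc.
have [N [mN N0 fN]] := ff'.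
(* The measurable version is integrated off the null set only; there it agrees with [h \o f], so
   monotonicity of the lower integral applies. *)
rewrite (ge0_negligible_integral mN)//; last 2 first.
- exact/measurable_EFinP.
- by move=> s _; rewrite lee_fin; exact: h0.
rewrite integral_mkcond; apply: le_ge0_integral => s.
  by apply: erestrict_ge0 => t _; rewrite lee_fin; exact: h0.
rewrite patchE; case: ifPn => [/set_mem[_ sN]|_]; last by rewrite lee_fin; exact: h0.
by rewrite /= (_ : f s = f' s)//; apply: contrapT => ?; apply: sN; exact: fN.
Qed.

End StronglyMeasurable.

(** * Integrals of simple functions *)

Section SimpleIntegral.
Context {R : realType} {d : measure_display} {T : measurableType d}.
Variable mu : {finite_measure set T -> \bar R}.
Context {U : choiceType} {V : normedModType R}.
Variable k : T -> U.
Hypothesis fin_k : finite_set (range k).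
Hypothesis mk : forall u, measurable (k @^-1` [set u]).

Local Notation mass u := (fine (mu (k @^-1` [set u]))).

Lemma fine_measure_preimage_comp (h : U -> V) v :
  fine (mu ((h \o k) @^-1` [set v])) =
  \sum_(u <- fset_set (range k)) (if h u == v then mass u else 0).
Proof.
rewrite (_ : _ @^-1` _ = \bigcup_(u in range k `&` h @^-1` [set v]) k @^-1` [set u]).
  rewrite measure_fin_bigcup//; last 2 first.
  - exact: finite_setIl.
  - by move=> u w _ _ [s [/= -> ->]].
  rewrite (@eq_fsbigr _ _ _ _ _ (fun u => (mass u)%:E)); last first.
    by move=> u _; rewrite fineK//; exact: fin_num_measure.
  rewrite fsumEFin/=; last exact: finite_setIl.
  rewrite fsbig_mkcondr fsbig_finite//=; apply: eq_bigr => u _.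
  by congr (if _ then _ else _); apply/idP/eqP => [/set_mem|huv]; last exact: mem_set.
apply/seteqP; split => s /=.
  by move=> <-; exists (k s) => //; split => //; exists s.
by move=> [u [_ /= <-] <-].
Qed.

(** Each fibre of [h \o k] is the disjoint union of the fibres of [k] it contains. Functions that
    factor through the same [k] can thus be integrated over one common partition. *)
Lemma simple_integral_comp (h : U -> V) : simple_integral mu (h \o k) =
  \sum_(u <- fset_set (range k)) mass u *: h u.
Proof.
rewrite /simple_integral.
have fin_hk : finite_set (range (h \o k)).
  by rewrite -(image_comp k h); apply: finite_image.
rewrite fsbig_finite//=.
under eq_bigr do rewrite fine_measure_preimage_comp scaler_suml.
rewrite exchange_big/=; apply: eq_big_seq => u.
rewrite in_fset_set// inE => -[s _ su].
rewrite (bigD1_seq (h u))/=; last exact: fset_uniq; last first.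
  by rewrite in_fset_set// inE; exists s => //=; rewrite su.
rewrite eqxx big1 ?addr0// => v; rewrite eq_sym => /negbTE ->.
by rewrite scale0r.
Qed.

Lemma integral_simple_comp (phi : U -> R) : (forall u, 0 <= phi u) ->
  (\int[mu]_s (phi (k s))%:E =
   (\sum_(u <- fset_set (range k)) mass u * phi u)%:E)%E.
Proof.
move=> phi0.
rewrite (eq_integral (fun s => \sum_(u <- fset_set (range k))
  (phi u)%:E * (\1_(k @^-1` [set u]) s)%:E)%E); last first.
  move=> s _; rewrite (bigD1_seq (k s))/=; last exact: fset_uniq; last first.
    by rewrite in_fset_set// inE; exists s.
  rewrite big1; first by rewrite indicE mem_set//= mule1 adde0.
  move=> u uks; rewrite indicE memNset ?mule0//= => ksu.
  by rewrite ksu eqxx in uks.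
rewrite ge0_integral_sum//; last 2 first.
- move=> u; apply: measurable_funeM; apply/measurable_EFinP.
  exact: measurable_indic.
- by move=> u s _; apply: mule_ge0; rewrite lee_fin.
rewrite -sumEFin; apply: eq_bigr => u _.
rewrite ge0_integralZl_EFin//; last first.
  by apply/measurable_EFinP; exact: measurable_indic.
rewrite integral_indic// setIT EFinM muleC fineK//.
exact: fin_num_measure.
Qed.

End SimpleIntegral.

Lemma simple_integral_dist {R : realType} {d : measure_display} {T : measurableType d}
  {V : normedModType R} (mu : {finite_measure set T -> \bar R}) (f g : T -> V) c :
  is_simple f -> is_simple g -> upper_integral_le mu (fun s => `|f s - g s|) c ->
  `|simple_integral mu f - simple_integral mu g| <= c.
Proof.
move=> sf sg /upper_integral_leP fgc.
(* The fibres of the pair form a common refinement of the partitions of [f] and [g], on which the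
   claim is the triangle inequality for finite sums. *)
pose k s := (f s, g s).
have fin_k : finite_set (range k).
  apply: (@sub_finite_set _ _ (range f `*` range g)).
    by move=> _ [s _ <-]; split => /=; exists s.
  by apply: finite_setX; [case: sf|case: sg].
have mk u : measurable (k @^-1` [set u]).
  rewrite (_ : _ @^-1` _ = f @^-1` [set u.1] `&` g @^-1` [set u.2]).
    by apply: measurableI; apply: is_simple_preimage.
  by apply/seteqP; split => s /=; [move=> <-|move: u => [? ?] /= [<- <-]].
have -> : f = fst \o k by [].
have -> : g = snd \o k by [].
rewrite !simple_integral_comp// -sumrB.
rewrite -lee_fin; apply: le_trans (fgc _); last by [].
rewrite (integral_simple_comp mu fin_k mk (phi := fun u => `|u.1 - u.2|))//.
rewrite lee_fin; apply: le_trans (ler_norm_sum _ _ _) _.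
apply: ler_sum => u _; rewrite -scalerBr normrZ ger0_norm//.
exact: fine_ge0.
Qed.

(** * Bochner integrable functions *)

Section L1Approx.
Context {R : realType} {d : measure_display} {T : measurableType d}.
Variable mu : {measure set T -> \bar R}.
Context {V : normedModType R}.
Implicit Types f g : T -> V.

(** Bochner integrability as membership in the L_1 closure of the simple functions. With the upper
    integral, strong measurability of [f] is a consequence and not an assumption. *)
Definition L1_approx f := forall e : R, 0 < e ->
  exists h, is_simple h /\ upper_integral_le mu (fun s => `|f s - h s|) e.

Lemma upper_integral_le_triangle f g h c e :
  upper_integral_le mu (fun s => `|f s - g s|) c ->
  upper_integral_le mu (fun s => `|g s - h s|) e ->
  upper_integral_le mu (fun s => `|f s - h s|) (c + e).
Proof.
move=> fg gh; apply: upper_integral_leS (upper_integral_leD fg gh) => s.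
exact: ler_distD.
Qed.

Lemma L1_approx_closed f :
  (forall e : R, 0 < e -> exists g, L1_approx g /\
     upper_integral_le mu (fun s => `|f s - g s|) e) -> L1_approx f.
Proof.
move=> fg e e0; have e20 : 0 < e / 2 by rewrite divr_gt0.
have [g [/(_ _ e20)[h [sh gh]] fgc]] := fg _ e20.
exists h; split => //; rewrite (splitr e).
exact: upper_integral_le_triangle gh.
Qed.

(* Truncating the n-th approximant to 0 where its norm exceeds 2|f| keeps
   pointwise convergence, and 3|f| then dominates the error. *)
Lemma strongly_measurable_L1_approx f c : strongly_measurable mu f ->
  upper_integral_le mu (fun s => `|f s|) c -> L1_approx f.
Proof.
move=> /strongly_measurable_everywhere[f' [g [sg gf ff']]] fc e e0.
have f'c : (\int[mu]_s (`|f' s|)%:E <= c%:E)%E.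
  apply: upper_integral_leP => //; apply: upper_integral_le_ae fc.
  by apply: filterS ff' => s ->.
have mnf' : measurable_fun setT (fun s => `|f' s|).
  by apply: (measurable_limit_comp _ sg gf); exact: norm_continuous.
pose h n s := if `|g n s| <= 2 * `|f' s| then g n s else 0.
have sh n : is_simple (h n).
  apply: is_simple_if; [|exact: sg|exact: is_simple_cst].
  rewrite -[X in measurable X]setTI.
  apply: (measurable_fun_ler _ _ measurableT) => //.
    by apply: (measurable_simple_comp (fun v => `|v|)).
  exact: measurable_funM.
have hf s : h n s @[n --> \oo] --> f' s.
  (* Where the limit is 0 the truncated sequence is identically 0; elsewhere the truncation is
     eventually inactive, because [2 * |f' s|] strictly exceeds the limit of the norms. *)
  have [f0|f0] := eqVneq (f' s) 0.
    rewrite f0; apply: cvg_near_cst; near=> n.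
    by rewrite /h f0 normr0 mulr0 normr_le0; case: ifPn => // /eqP.
  apply: cvg_trans (gf s); apply: near_eq_cvg.
  have : `|g n s| @[n --> \oo] --> `|f' s| by apply: cvg_norm; exact: gf.
  move=> /cvgr_le/(_ (2 * `|f' s|)); rewrite ltr_pMl ?normr_gt0// ltr1n => /(_ isT).
  by apply: filterS => n gn; rewrite /h gn.
have hb n s : `|f' s - h n s| <= 3 * `|f' s|.
  rewrite (le_trans (ler_normB _ _))// /h; case: ifPn => [gn|_].
    by rewrite (_ : 3 = 1 + 2 :> R)// mulrDl mul1r lerD2l.
  by rewrite normr0 addr0 ler_peMl// ler1n.
have mfh n : measurable_fun setT (fun s => `|f' s - h n s|).
  apply: (@measurable_limit_comp _ _ _ _ (fun s => f' s - h n s)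
    (fun m s => g m s - h n s) Num.norm).
  - exact: norm_continuous.
  - by move=> m; apply: (is_simple_comp2 (fun v w => v - w)).
  - by move=> s; apply: cvgB; [exact: gf|exact: cvg_cst].
have [|||||_ _] := @dominated_convergence _ _ _ mu setT measurableT
  (fun n s => (`|f' s - h n s|)%:E) (cst 0%E) (fun s => (3 * `|f' s|)%:E).
- by move=> n; apply/measurable_EFinP; exact: mfh.
- exact: measurable_cst.
- apply: aeW => s _; apply: cvg_EFin; first by near=> n.
  rewrite -(normr0 V) -(subrr (f' s)).
  by apply: cvg_norm; apply: cvgB; [exact: cvg_cst|exact: hf].
- apply/integrableP; split.
    by apply/measurable_EFinP; exact: measurable_funM.
  under eq_integral do rewrite gee0_abs ?lee_fin// EFinM.
  rewrite ge0_integralZl_EFin//; last exact/measurable_EFinP.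
  apply: le_lt_trans (ltry (3 * c)); rewrite EFinM.
  by apply: lee_wpmul2l.
- apply: aeW => s n _; rewrite gee0_abs ?lee_fin//; exact: hb.
rewrite integral0 => /fine_cvgP[fin_int /cvgr_le/(_ e e0) le_e].
have [N _ hN] : \forall n \near \oo,
    (\int[mu]_s (`|f' s - h n s|)%:E <= e%:E)%E.
  by apply: filterS2 fin_int le_e => n fin; rewrite /= -lee_fin fineK.
exists (h N); split => //.
apply: (@upper_integral_le_ae _ _ _ _ _ (fun s => `|f' s - h N s|)).
  by apply: filterS ff' => s ->.
by apply: measurable_upper_integral_le => //; exact: hN (leqnn N).
Unshelve. all: by end_near. Qed.

(* Borel-Cantelli: the errors are dominated by measurable functions whose
   integrals are summable. *)
Lemma L1_approx_strongly_measurable f : L1_approx f -> strongly_measurable mu f.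
Proof.
move=> fL1.
have pos n : 0 < 1 / (2 ^ (n + 1))%:R :> R by rewrite divr_gt0// ltr0n expn_gt0.
have /choice[h /all_and2[sh /choice[k /all_and4[mk k0 fhk kn]]]] :=
  fun n => fL1 _ (pos n).
exists h; split => //.
have sumk : (\int[mu]_s (\sum_(n <oo) k n s) < +oo)%E.
  rewrite integral_nneseries//.
  apply: (@le_lt_trans _ _ (\sum_(n <oo) (1 / (2 ^ (n + 1))%:R : R)%:E)%E).
    apply: lee_nneseries => [n _ _|n _]; [exact: integral_ge0|exact: kn].
  by rewrite (cvg_lim _ (@cvg_geometric_eseries_half R 1 0))// ltry.
have : mu.-integrable setT (fun s => \sum_(n <oo) k n s)%E.
  apply/integrableP; split; first exact: ge0_emeasurable_sum.
  under eq_integral do rewrite gee0_abs ?nneseries_ge0//.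
  exact: sumk.
move=> /(integrable_ae measurableT).
have := ae_foralln fhk; apply: filterS2 => s fhks /(_ I) fins.
have : (\sum_(n <oo) k n s < +oo)%E by rewrite -ge0_fin_numE// nneseries_ge0.
(* A convergent series has vanishing tails, and the n-th majorant is at most the tail that starts at
   n. *)
move=> /(@nneseries_tail_cvg _ (fun n => k n s) xpredT)/(_ (fun n _ => k0 n s)).
move=> /fine_cvgP[tfin tcvg]; apply/cvgrPdist_le => e e0.
move/cvgr_le : tcvg => /(_ e e0); apply: filterS2 tfin => n tfin /=.
rewrite -lee_fin fineK// => tn.
rewrite -lee_fin (le_trans (fhks n))// (le_trans _ tn)//.
rewrite (@nneseries_split _ _ n 1)//.
by rewrite addn1 big_nat1 leeDl// nneseries_ge0// => m _ _; exact: k0.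
Qed.

End L1Approx.

Section BochnerIntegral.
Context {R : realType} {d : measure_display} {T : measurableType d}.
Variable mu : {finite_measure set T -> \bar R}.

(** Passes the estimate for simple functions to the limit: the two approximants are within [e / 2]
    of [f] and [g], hence within [c + e] of each other. *)
Lemma is_Bochner_integral_dist {V : normedModType R} (f g : T -> V) (I J : V) c :
  is_Bochner_integral mu f I -> is_Bochner_integral mu g J ->
  upper_integral_le mu (fun s => `|f s - g s|) c -> `|I - J| <= c.
Proof.
move=> [mf [f_ [sf ff fI]]] [mg [g_ [sg gg gJ]]] fgc.
apply/ler_addgt0Pr => e e0.
(* The convergence in the definition of the integral concerns lower integrals; strong measurability
   of the error turns it into a bound on upper integrals. *)
have near_le (u : T -> V) (u_ : nat -> T -> V) : strongly_measurable mu u ->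
    (forall n, is_simple (u_ n)) ->
    (\int[mu]_s (`|u s - u_ n s|)%:E)%E @[n --> \oo] --> 0%E ->
    \forall n \near \oo, upper_integral_le mu (fun s => `|u s - u_ n s|) (e / 2).
  move=> mu_ su /fine_cvgP[fin_int /cvgr_le/(_ (e / 2))].
  rewrite divr_gt0// => /(_ isT); apply: filterS2 fin_int => n fin.
  rewrite /= -lee_fin fineK// => le_e.
  apply: (@strongly_measurable_upper_integral_le _ _ _ mu _ (fun s => u s - u_ n s)
    Num.norm) => //.
  - exact: norm_continuous.
  - by apply: strongly_measurableB => //; exact: is_simple_strongly_measurable.
have lim : `|simple_integral mu (f_ n) - simple_integral mu (g_ n)|
    @[n --> \oo] --> `|I - J| by apply: cvg_norm; exact: cvgB.
apply: (cvgr_to_le lim).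
apply: filterS2 (near_le _ _ mf sf ff) (near_le _ _ mg sg gg) => n fn gn.
apply: simple_integral_dist => //.
rewrite (_ : c + e = e / 2 + (c + e / 2)); last by field.
apply: upper_integral_le_triangle; last exact: upper_integral_le_triangle fgc gn.
by apply: upper_integral_leS fn => s; rewrite distrC.
Qed.

(** Simple approximants with error 1/(n+1) have integrals forming a Cauchy sequence, and
    completeness of [V] supplies the limit. So [xget] returns a genuine integral here, not its
    default. *)
Lemma L1_approx_Bochner_integral {V : completeNormedModType R} (f : T -> V) :
  L1_approx mu f -> is_Bochner_integral mu f (Bochner_integral mu f).
Proof.
move=> fL1; suff [I fI] : exists I, is_Bochner_integral mu f I.
  by apply: (xgetPex 0); exists I.
have pos n : 0 < n.+1%:R^-1 :> R by rewrite invr_gt0 ltr0n.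
have /choice[h /all_and2[sh fh]] := fun n => fL1 _ (pos n).
have Sdist m n : `|simple_integral mu (h m) - simple_integral mu (h n)| <=
    m.+1%:R^-1 + n.+1%:R^-1.
  apply: simple_integral_dist => //; apply: upper_integral_le_triangle (fh n).
  by apply: upper_integral_leS (fh m) => s; rewrite distrC.
have : cvg (simple_integral mu (h n) @[n --> \oo]).
  apply: cauchy_cvg; apply: cauchy_exP => e e0.
  have /cvgr_lt/(_ (e / 2)) := @cvg_harmonic R.
  rewrite divr_gt0// => /(_ isT)[N _ hN].
  exists (simple_integral mu (h N)); exists N => // n /= Nn.
  rewrite -ball_normE /=; apply: le_lt_trans (Sdist N n) _.
  by rewrite (splitr e) ltrD//; apply: hN => /=.
move=> /cvg_ex[I hI]; exists I; split.
  exact: L1_approx_strongly_measurable.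
exists h; split => //.
apply: (@squeeze_cvge _ _ _ _ (cst 0%E) _ (fun n => (n.+1%:R^-1)%:E)).
- apply: nearW => n; rewrite integral_ge0//=.
  exact: upper_integral_leP.
- exact: cvg_cst.
- by apply: cvg_EFin; [exact: nearW|exact: cvg_harmonic].
Qed.

Lemma Bochner_integral_dist {V : completeNormedModType R} (f g : T -> V) c :
  L1_approx mu f -> L1_approx mu g ->
  upper_integral_le mu (fun s => `|f s - g s|) c ->
  `|Bochner_integral mu f - Bochner_integral mu g| <= c.
Proof.
move=> /L1_approx_Bochner_integral fI /L1_approx_Bochner_integral gJ.
exact: is_Bochner_integral_dist.
Qed.

End BochnerIntegral.

(** * Sections in a product space *)

Section Sections.
Context {R : realType} {d0 d : measure_display}
  {T0 : measurableType d0} {T : measurableType d}.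
Variables (mu0 : {finite_measure set T0 -> \bar R})
  (mu : {finite_measure set T -> \bar R}).

(** The product measure of [N] is the integral of the measures of its sections, so almost every
    section of a null set is null. *)
Lemma ae_xsection (P : T0 * T -> Prop) :
  {ae (mu0 \x mu)%E, forall z, P z} ->
  {ae mu0, forall xi, {ae mu, forall s, P (xi, s)}}.
Proof.
move=> [N [mN N0 PN]].
have : (\int[mu0]_xi `|mu (xsection N xi)| = 0)%E.
  rewrite -[RHS]N0 /product_measure1/=; apply: eq_integral => xi _.
  by rewrite gee0_abs.
move=> /(ae_eq_integral_abs mu0 measurableT); move=> /(_ (measurable_fun_xsection mu mN)).
apply: filterS => xi /(_ I) /= Nxi0.
exists (xsection N xi); split => //; first exact: measurable_xsection.
by move=> s /= nP; rewrite /xsection /= inE; exact: PN.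
Qed.

Lemma is_simple_section {V : normedModType R} (f : T0 * T -> V) xi :
  is_simple f -> is_simple (fun s => f (xi, s)).
Proof.
move=> [fin mf]; split.
  by apply: sub_finite_set fin => _ [s _ <-]; exists (xi, s).
move=> v; rewrite (_ : _ @^-1` _ = xsection (f @^-1` [set v]) xi).
  exact: measurable_xsection.
by apply/seteqP; split => s; rewrite /xsection /= inE.
Qed.

Lemma strongly_measurable_section {V : normedModType R} (f : T0 * T -> V) :
  strongly_measurable (mu0 \x mu)%E f ->
  {ae mu0, forall xi, strongly_measurable mu (fun s => f (xi, s))}.
Proof.
move=> [g [sg /ae_xsection]]; apply: filterS => xi gf.
by exists (fun n s => g n (xi, s)); split => // n; exact: is_simple_section.
Qed.

(** By Tonelli the section integrals of the majorant have a finite integral in [xi], hence are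
    finite for almost every [xi]. *)
Lemma upper_integral_le_section (f : T0 * T -> R) c :
  upper_integral_le (mu0 \x mu)%E f c ->
  {ae mu0, forall xi, exists c', upper_integral_le mu (fun s => f (xi, s)) c'}.
Proof.
move=> [g [mg g0 /ae_xsection fg gc]].
have : mu0.-integrable setT (fubini_F mu g).
  apply/integrableP; split; first exact: measurable_fun_fubini_tonelli_F.
  rewrite (eq_integral (fubini_F mu g)); last first.
    by move=> xi _; rewrite gee0_abs//; exact: integral_ge0.
  rewrite -fubini_tonelli1//; exact: le_lt_trans gc (ltry c).
move=> /(integrable_ae measurableT); apply: filterS2 fg => xi fg /(_ I) fin.
exists (fine (fubini_F mu g xi)), (fun s => g (xi, s)); split => //.
- exact: (measurableT_comp mg (pair1_measurable xi)).
- by rewrite fineK.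
Qed.

End Sections.

(** * The Urysohn operator *)

Lemma ae_countable {R : realType} {d : measure_display} {T : measurableType d}
  (mu : {measure set T -> \bar R}) (I : Type) (D : set I) (P : I -> T -> Prop) :
  countable D -> (forall i, D i -> {ae mu, forall s, P i s}) ->
  {ae mu, forall s, forall i, D i -> P i s}.
Proof.
move=> /countable_injP[f finj] aeP.
have : forall n, {ae mu, forall s, forall i, D i -> f i = n -> P i s}.
  move=> n; have [[i Di fi]|noi] := pselect (exists2 i, D i & f i = n).
    apply: filterS (aeP i Di) => s Pis j Dj fj.
    by rewrite (finj j i) ?inE// fj fi.
  by apply: aeW => s i Di fi; exfalso; apply: noi; exists i.
by move=> /ae_foralln; apply: filterS => s Ps i Di; exact: (Ps (f i)).
Qed.

Lemma norm_infty_ge0 {R : realType} {d : measure_display} {T : measurableType d}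
  (mu : {measure set T -> \bar R}) (v : T -> R) : (0 <= norm_infty mu v)%E.
Proof.
by apply: le_ereal_inf_tmp => _ [rho [rho0 _] <-]; rewrite lee_fin ltW.
Qed.

(** The infimum is itself an essential bound: admissible bounds exist within 1/(n+1) of it, and the
    countably many exceptional null sets are united. *)
Lemma ae_le_norm_infty {R : realType} {d : measure_display} {T : measurableType d}
  (mu : {measure set T -> \bar R}) (v : T -> R) : (norm_infty mu v < +oo)%E ->
  {ae mu, forall s, v s <= fine (norm_infty mu v)}.
Proof.
move=> fin; have finN : norm_infty mu v \is a fin_num.
  by rewrite ge0_fin_numE// norm_infty_ge0.
have : forall n, {ae mu, forall s, v s <= fine (norm_infty mu v) + n.+1%:R^-1}.
  move=> n; have n0 : 0 < n.+1%:R^-1 :> R by rewrite invr_gt0 ltr0n.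
  have [_ [rho [_ vrho] <-]] := lb_ereal_inf_adherent n0 finN.
  rewrite -/(norm_infty mu v) -(fineK finN) -EFinD lte_fin => /ltW rholt.
  by apply: filterS vrho => s vs; exact: le_trans rholt.
move=> /ae_foralln; apply: filterS => s vs.
apply/ler_addgt0Pr => e e0.
have /cvgr_lt/(_ _ e0)[N _ /(_ N (leqnn N))/= hN] := @cvg_harmonic R.
by apply: le_trans (vs N) _; rewrite lerD2l ltW.
Qed.

Section Superposition.
Context {R : realType} {d : measure_display} {T : measurableType d}.
Variable mu : {finite_measure set T -> \bar R}.
Context {X Y : normedModType R}.

Lemma is_simple_upper_integral_le (h : T -> X) : is_simple h ->
  exists c, upper_integral_le mu (fun s => `|h s|) c.
Proof.
move=> sh; have [fin mh] := sh; eexists.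
apply: measurable_upper_integral_le => //.
  exact: (measurable_simple_comp (fun v => `|v|)).
by rewrite (integral_simple_comp mu fin mh (phi := Num.norm)).
Qed.

Lemma strongly_measurable_superposition_simple (k : T -> X -> Y) (h : T -> X) :
  is_simple h ->
  (forall v, range h v -> strongly_measurable mu (fun s => k s v)) ->
  strongly_measurable mu (fun s => k s (h s)).
Proof.
move=> sh mk.
have /choice[g gP] : forall v, exists g : nat -> T -> Y, range h v ->
    (forall n, is_simple (g n)) /\ {ae mu, forall s, g n s @[n --> \oo] --> k s v}.
  move=> v; have [/mk[g gP]|nv] := pselect (range h v); first by exists g.
  by exists (fun _ _ => 0).
exists (fun n s => g (h s) n s); split.
  move=> n; apply: (is_simple_dep_comp (k := fun v => g v n)) => // v /gP[sg _].
  exact: sg.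
have cnt : countable (range h) by apply: finite_set_countable; case: sh.
have := @ae_countable _ _ _ mu _ _ (fun v s => g v n s @[n --> \oo] --> k s v) cnt
  (fun v hv => (gP v hv).2).
by apply: filterS => s; apply; exists s.
Qed.

(* Lipschitz continuity lets the integrability of k s (h n s) for a sequence of
   simple approximations h n of x pass to the limit. *)
Lemma L1_approx_superposition (k : T -> X -> Y) (phi c : R) (x : T -> X)
    (h : nat -> T -> X) : 0 <= phi ->
  upper_integral_le mu (fun s => `|k s 0|) c ->
  {ae mu, forall s, forall x1 x2, `|k s x1 - k s x2| <= phi * `|x1 - x2|} ->
  (forall n, is_simple (h n)) ->
  (forall n, upper_integral_le mu (fun s => `|x s - h n s|) n.+1%:R^-1) ->
  (forall n v, range (h n) v -> strongly_measurable mu (fun s => k s v)) ->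
  L1_approx mu (fun s => k s (x s)).
Proof.
move=> phi0 k0c klip sh xh mk; apply: L1_approx_closed => e e0.
(* Adding 1 to [phi] keeps the quotient defined when [phi] is 0; an error 1/(N+1) below it becomes
   at most [e] after multiplication by [phi]. *)
have e1 : 0 < e / (phi + 1) by rewrite divr_gt0// ltr_wpDl.
have /cvgr_lt/(_ _ e1)[N _ /(_ N (leqnn N))/= hN] := @cvg_harmonic R.
exists (fun s => k s (h N s)); split.
  have [cN hcN] := is_simple_upper_integral_le (sh N).
  apply: (@strongly_measurable_L1_approx _ _ _ _ _ _ (c + phi * cN)).
    exact: strongly_measurable_superposition_simple (mk N).
  apply: upper_integral_le_ae (upper_integral_leD k0c (upper_integral_leZ phi0 hcN)).
  apply: filterS klip => s /(_ (h N s) 0); rewrite subr0 => kh.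
  by rewrite -lerBlDl; apply: le_trans kh; exact: lerB_dist.
apply: upper_integral_le_ae (upper_integral_leW _ (upper_integral_leZ phi0 (xh N))).
  by apply: filterS klip => s; exact.
move: hN; rewrite ltr_pdivlMr ?ltr_wpDl// => /ltW; apply: le_trans.
by rewrite mulrC ler_wpM2l ?invr_ge0// lerDl.
Qed.

End Superposition.

Lemma Bnorm1 {R : realType} {d : measure_display} {T : measurableType d}
  {V : normedModType R} (mu : {measure set T -> \bar R}) (f : T -> V) :
  Bnorm mu 1 f = (\int[mu]_s (`|f s|)%:E)%E.
Proof.
by rewrite /Bnorm Lnorm1; apply: eq_integral => s _; rewrite gee0_abs// lee_fin.
Qed.

Lemma Lp1_upper_integral_le {R : realType} {d : measure_display}
  {T : measurableType d} {V : normedModType R} (mu : {measure set T -> \bar R})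
  (f : T -> V) : Lp mu 1 f -> exists c, upper_integral_le mu (fun s => `|f s|) c.
Proof.
move=> [mf]; rewrite Bnorm1 => ffin; exists (fine (\int[mu]_s (`|f s|)%:E)%E).
apply: (@strongly_measurable_upper_integral_le _ _ _ _ _ _ Num.norm) => //.
  exact: norm_continuous.
by rewrite fineK// ge0_fin_numE//; exact: integral_ge0.
Qed.

Section UrysohnOperator.
Context {R : realType} {d0 d : measure_display}
  {Omega0 : measurableType d0} {Omega : measurableType d}
  {X : normedModType R} {Y : completeNormedModType R}.
Variables (mu0 : {finite_measure set Omega0 -> \bar R})
  (mu : {finite_measure set Omega -> \bar R}) (K : Omega0 -> Omega -> X -> Y)
  (psi : Omega0 -> Omega -> R).
Hypothesis K_meas : forall x : X, strongly_measurable (mu0 \x mu)%E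
  (fun z : Omega0 * Omega => K z.1 z.2 x).
Hypothesis K0_L1 : Lp (mu0 \x mu)%E 1 (fun z : Omega0 * Omega => K z.1 z.2 0).
Hypothesis psi_Linfty : {ae mu0, forall xi, Linfty_nonneg mu (psi xi)}.
Hypothesis K_Lip : {ae (mu0 \x mu)%E, forall z : Omega0 * Omega,
  forall x1 x2 : X, `|K z.1 z.2 x1 - K z.1 z.2 x2| <= psi z.1 z.2 * `|x1 - x2|}.

Local Notation phi xi := (fine (norm_infty mu (psi xi))).

Lemma ae_section_Lipschitz : {ae mu0, forall xi, {ae mu, forall s, forall x1 x2,
  `|K xi s x1 - K xi s x2| <= phi xi * `|x1 - x2|}}.
Proof.
apply: filterS2 psi_Linfty (ae_xsection K_Lip) => xi [_ _ /ae_le_norm_infty].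
apply: filterS2 => s psi_phi Klip x1 x2; apply: le_trans (Klip x1 x2) _.
exact: ler_wpM2r.
Qed.

(** For each fixed [v] the sections of [K] at [v] are measurable off a null set of [xi]. A sequence
    of simple approximants of [x] has only countably many values, so one null set serves for all of
    them. *)
Lemma ae_L1_approx_section (x : Omega -> X) : L1_approx mu x ->
  {ae mu0, forall xi, L1_approx mu (fun s => K xi s (x s))}.
Proof.
move=> xL1.
have pos n : 0 < n.+1%:R^-1 :> R by rewrite invr_gt0 ltr0n.
have /choice[h /all_and2[sh xh]] := fun n => xL1 _ (pos n).
have Kh : {ae mu0, forall xi, forall n v, range (h n) v ->
    strongly_measurable mu (fun s => K xi s v)}.
  apply: ae_foralln => n.
  apply: (ae_countable (P := fun v xi => strongly_measurable mu (fun s => K xi s v))).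
    by apply: finite_set_countable; case: (sh n).
  by move=> v _; exact: (strongly_measurable_section (K_meas v)).
have [c /upper_integral_le_section K0] := Lp1_upper_integral_le K0_L1.
have := ae_section_Lipschitz; apply: filterS3 K0 Kh => xi [c' K0c] Khn Klip.
exact: (L1_approx_superposition (fine_ge0 (norm_infty_ge0 mu (psi xi))) K0c Klip sh).
Qed.

(** For almost every [xi] the two Bochner integrals differ by at most [phi xi * c]. Only the
    majorant of [phi] is then integrated, so no measurability of the images is required. *)
Lemma Urysohn_dist (C c : R) (x y : Omega -> X) :
  upper_integral_le mu0 (fun xi => phi xi) C ->
  L1_approx mu x -> L1_approx mu y ->
  upper_integral_le mu (fun s => `|x s - y s|) c ->
  (Bnorm mu0 1 (fun xi => Urysohn mu K x xi - Urysohn mu K y xi)%R <= (C * c)%:E)%E.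
Proof.
move=> phiC xL1 yL1 xyc; rewrite Bnorm1.
have c0 := upper_integral_le_ge0 xyc.
apply: upper_integral_leP => //; rewrite mulrC.
apply: upper_integral_le_ae (upper_integral_leZ c0 phiC).
apply: filterS3 (ae_L1_approx_section xL1) (ae_L1_approx_section yL1)
  ae_section_Lipschitz => xi Kx Ky Klip.
rewrite /Urysohn mulrC; apply: Bochner_integral_dist => //.
apply: upper_integral_le_ae
  (upper_integral_leZ (fine_ge0 (norm_infty_ge0 mu (psi xi))) xyc).
by apply: filterS Klip => s; exact.
Qed.

End UrysohnOperator.

(** * Comparison of the balls *)

Section PowerDistance.
Context {R : realType}.
Implicit Types x y u a c m p : R.

(** With y <= x, factor out exp x and use 1 + t <= exp t at t = y - x. *)
Lemma expR_dist_le x y : `|expR x - expR y| <= `|x - y| * Num.max (expR x) (expR y).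
Proof.
wlog yx : x y / y <= x.
  move=> H; case/orP: (le_total y x) => [|xy]; first exact: H.
  by rewrite distrC (distrC x y) maxC; exact: H.
rewrite max_l ?ler_expR// !ger0_norm ?subr_ge0 ?ler_expR//.
have -> : expR y = expR x * expR (- (x - y)) by rewrite -expRD; congr expR; ring.
have := ler_wpM2l (expR_ge0 x) (expR_ge1Dx (- (x - y))).
by rewrite mulrDr mulr1 mulrN; lra.
Qed.

(** The logarithm costs a factor u^c / c for u >= 1 and u^(-c) / c for u <= 1. The margins [c <= m]
    and [m + c <= p] absorb it into u^p and into 1 respectively. *)
Lemma abs_ln_powR_le u c m p : 0 < u -> 0 < c -> c <= m -> m + c <= p ->
  `|ln u| * u `^ m <= (1 + u `^ p) / c.
Proof.
move=> u0 c0 cm mcp; rewrite ler_pdivlMr// mulrAC.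
have [u1|/ltW u1] := lerP 1 u.
  rewrite ger0_norm ?ln_ge0//.
  have : ln u * c <= u `^ c by rewrite mulrC -ln_powR ltW// ln_sublinear// powR_gt0.
  move=> /(ler_wpM2r (powR_ge0 u m))/le_trans; apply.
  rewrite -powRD; last by rewrite (gt_eqF u0) implybT.
  apply: (@le_trans _ _ (u `^ p)); last by rewrite lerDr.
  by apply: ler_powR => //; rewrite addrC.
rewrite ler0_norm ?ln_le0//.
have : - ln u * c <= u `^ (- c).
  by rewrite mulNr -mulrN mulrC -ln_powR ltW// ln_sublinear// powR_gt0.
move=> /(ler_wpM2r (powR_ge0 u m))/le_trans; apply.
rewrite -powRD; last by rewrite (gt_eqF u0) implybT.
apply: (@le_trans _ _ (u `^ 0)); last by rewrite powRr0 lerDl powR_ge0.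
by apply: ger_powR; rewrite ?u0// addrC subr_ge0.
Qed.

(** Write u and u^a as exponentials of ln u and a ln u. The larger of the two is u^m with m = 1 or m
    = a, and the hypotheses give both exponents the margin [c] inside [0, p]. *)
Lemma powR_dist_le u a c p : 0 <= u -> 0 < c -> c <= 1 -> c <= a ->
  1 + c <= p -> a + c <= p -> `|u - u `^ a| <= `|a - 1| / c * (1 + u `^ p).
Proof.
move=> u0 c0 c1 ca cp acp; have a0 := lt_le_trans c0 ca.
move: u0; rewrite le_eqVlt => /predU1P[<-|u0].
  rewrite powR0 ?gt_eqF// subrr normr0.
  by rewrite mulr_ge0// ?divr_ge0// ?addr_ge0 ?powR_ge0// ltW.
have ue : u = u `^ 1 by rewrite powRr1// ltW.
have -> : u `^ a = expR (a * ln u) by rewrite /powR gt_eqF.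
rewrite -[in X in `|X - _|](lnK u0); apply: le_trans (expR_dist_le _ _) _.
have -> : `|ln u - a * ln u| = `|a - 1| * `|ln u|.
  by rewrite -normrM -normrN; congr `|_|; ring.
rewrite -mulrA -mulrA ler_wpM2l// mulrC.
rewrite lnK// (_ : expR (a * ln u) = u `^ a); last by rewrite /powR gt_eqF.
rewrite mulrC [leRHS]mulrC; case: (lerP u (u `^ a)) => _.
  exact: abs_ln_powR_le.
by rewrite [X in _ * X]ue; exact: abs_ln_powR_le.
Qed.

End PowerDistance.

Section RadialMap.
Context {R : realType} {V : normedModType R}.

Lemma powR_continuous_gt0 (a t : R) : 0 < t -> {for t, continuous (fun u : R => u `^ a)}.
Proof.
move=> t0; apply: differentiable_continuous; apply/derivable1_diffP.
by apply: derivable_powR; rewrite in_itv/= t0.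
Qed.

Lemma continuous_norm_powR (p : R) : 0 < p -> continuous (fun v : V => `|v| `^ p).
Proof.
move=> p0 v; have [->|v0] := eqVneq v 0; last first.
  apply: (@continuous_comp _ _ _ (fun v : V => `|v|) (fun u => u `^ p)).
    exact: norm_continuous.
  by apply: powR_continuous_gt0; rewrite normr_gt0.
rewrite /continuous_at normr0 powR0 ?gt_eqF//.
apply/cvgr0Pnorm_le => e e0.
(* The radius e^(1/p) is the one whose p-th power is [e]. *)
have : \forall v \near (0 : V), `|v| <= e `^ p^-1.
  by apply: nbhs0_le; exact: powR_gt0.
apply: filterS => w we; rewrite ger0_norm ?powR_ge0//.
rewrite (le_trans (ge0_ler_powR (ltW p0) _ _ we))// ?nnegrE ?powR_ge0//.
by rewrite -powRrM mulVf ?gt_eqF// powRr1// ltW.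
Qed.

(** At [v = 0] the value of the power is immaterial, since it multiplies the zero vector. *)
Definition radial (a r : R) (v : V) : V := (`|v| / r) `^ (a - 1) *: v.

Variables a r : R.
Hypotheses (a0 : 0 < a) (r0 : 0 < r).

Lemma norm_radial v : `|radial a r v| = r * (`|v| / r) `^ a.
Proof.
rewrite /radial normrZ ger0_norm ?powR_ge0//.
rewrite -[in RHS]mulr_powRB1 ?divr_ge0// ?ltW//.
by rewrite mulrA (mulrC r) divfK ?gt_eqF// mulrC.
Qed.

Lemma radial_dist v : `|v - radial a r v| = r * `| `|v| / r - (`|v| / r) `^ a|.
Proof.
rewrite /radial; set u := `|v| / r.
have u0 : 0 <= u by rewrite divr_ge0// ltW.
have vu : `|v| = r * u by rewrite mulrC divfK ?gt_eqF.
rewrite -{1}(scale1r v) -scalerBl normrZ vu mulrCA; congr (r * _).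
rewrite -[X in _ * X = _](ger0_norm u0) -normrM mulrBl mul1r (mulrC _ u).
by rewrite mulr_powRB1.
Qed.

(** Continuity keeps the rescaled function strongly measurable. At 0 the coefficient may be
    unbounded, as a < 1 is allowed, so continuity there is read off from the norm r u^a with a >
    0. *)
Lemma continuous_radial : continuous (radial a r).
Proof.
move=> v; have [->|v0] := eqVneq v 0.
  rewrite /continuous_at {2}/radial scaler0; apply: norm_cvg0.
  rewrite (_ : (fun x => _) = (fun v : V => r / r `^ a * `|v| `^ a)); last first.
    apply/funext => w; rewrite norm_radial powRM// ?invr_ge0 ?ltW//.
    by rewrite -powR_inv1 ?ltW// -powRrM mulN1r powRN; ring.
  rewrite -(mulr0 (r / r `^ a)); apply: cvgMl_tmp.
  have := @continuous_norm_powR a a0 0; rewrite /continuous_at.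
  by rewrite normr0 powR0// gt_eqF.
apply: cvgZ; last exact: cvg_id.
apply: (@continuous_comp _ _ _ (fun v : V => `|v| / r) (fun u => u `^ (a - 1))).
  by apply: cvgMr_tmp; exact: norm_continuous.
by apply: powR_continuous_gt0; rewrite divr_gt0// normr_gt0.
Qed.

End RadialMap.

Section BallTransfer.
Context {R : realType} {d : measure_display} {T : measurableType d}
  {V : normedModType R}.
Variable mu : {finite_measure set T -> \bar R}.
Implicit Types (p q r c : R) (x : T -> V).

Lemma Bnorm_leP p r x : 0 < p -> 0 <= r ->
  ((Bnorm mu p x <= r%:E) = (\int[mu]_s (`|x s| `^ p)%:E <= (r `^ p)%:E))%E.
Proof.
move=> p0 r0.
have -> : (\int[mu]_s (`|x s| `^ p)%:E = Bnorm mu p x `^ p)%E.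
  rewrite /Bnorm (poweR_Lnorm mu (fun s => (`|x s|)%:E) (lt0r_neq0 p0)).
  apply: eq_integral => s _.
  by rewrite gee0_abs// lee_fin.
have N0 : (0 <= Bnorm mu p x)%E by exact: Lnorm_ge0.
rewrite -poweR_EFin; apply/idP/idP => [|H].
  by apply: gt0_ler_poweR; rewrite ?in_itv/= ?leey ?andbT ?lee_fin// ltW.
have : ((Bnorm mu p x `^ p) `^ p^-1 <= (r%:E `^ p) `^ p^-1)%E.
  by apply: gt0_ler_poweR H; rewrite ?invr_ge0 ?(ltW p0)// in_itv/= leey andbT ?lee_fin
    ?powR_ge0// poweR_ge0.
by rewrite -!poweRrM mulfV ?gt_eqF// !poweRe1.
Qed.

Lemma Lp_ball_upper_integral_le p r x : 0 < p -> 0 < r -> Lp_ball mu p r x ->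
  upper_integral_le mu (fun s => (`|x s| / r) `^ p) 1.
Proof.
move=> p0 r0 [[mx _]]; rewrite (Bnorm_leP _ p0 (ltW r0)) => xr.
have /(upper_integral_leZ (k := (r `^ p)^-1)) :=
  strongly_measurable_upper_integral_le (continuous_norm_powR p0)
    (fun v => powR_ge0 `|v| p) mx xr.
rewrite invr_ge0 powR_ge0 mulVf ?gt_eqF ?powR_gt0// => /(_ isT).
apply: upper_integral_leS => s /=.
by rewrite powRM ?invr_ge0 ?(ltW r0)// -(powR_inv1 (ltW r0)) -powRrM mulN1r powRN mulrC.
Qed.

Lemma upper_integral_le_cst1 : upper_integral_le mu (fun=> 1) (fine (mu setT)).
Proof.
apply: measurable_upper_integral_le => //.
by rewrite integral_cst// mul1e fineK//; exact: fin_num_measure.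
Qed.

(** Since u <= 1 + u^p for p >= 1, finiteness of the measure puts the ball inside L_1. *)
Lemma Lp_ball_L1_approx p r x : 1 <= p -> 0 < r -> Lp_ball mu p r x ->
  L1_approx mu x.
Proof.
move=> p1 r0 xB; have p0 : 0 < p by exact: lt_le_trans p1.
have mx : strongly_measurable mu x by case: xB => [[]].
have H := upper_integral_leZ (ltW r0)
  (upper_integral_leD upper_integral_le_cst1 (Lp_ball_upper_integral_le p0 r0 xB)).
apply: (strongly_measurable_L1_approx mx); apply: upper_integral_leS H => s /=.
rewrite -ler_pdivrMl// mulrC; set u := _ / r.
have u0 : 0 <= u by rewrite divr_ge0// ltW.
have [u1|/ltW u1] := lerP u 1.
  by rewrite (le_trans u1)// lerDl powR_ge0.
by rewrite (le_trans (le1r_powR u1 p1))// lerDr.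
Qed.

(** With a = p / q the image satisfies |y|^q = r^q u^p, so it stays in the ball of the same radius.
    The distance bound integrates [powR_dist_le]: the term 1 contributes the total mass and u^p at
    most 1. *)
Lemma Lp_ball_transfer p q r c x : 0 < p -> 0 < q -> 0 < r -> 0 < c -> c <= 1 ->
  c <= p / q -> 1 + c <= p -> p / q + c <= p -> Lp_ball mu p r x ->
  exists y, Lp_ball mu q r y /\ upper_integral_le mu (fun s => `|x s - y s|)
    (`|p / q - 1| * (r / c * (fine (mu setT) + 1))).
Proof.
move=> p0 q0 r0 c0 c1 ca cp acp xB.
have a0 : 0 < p / q by rewrite divr_gt0.
have mx : strongly_measurable mu x by case: xB => [[]].
have xp := Lp_ball_upper_integral_le p0 r0 xB.
exists (radial (p / q) r \o x); split.
  have my : strongly_measurable mu (radial (p / q) r \o x).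
    by apply: strongly_measurable_comp => //; exact: continuous_radial.
  have yr : (Bnorm mu q (radial (p / q) r \o x) <= r%:E)%E.
    rewrite (Bnorm_leP _ q0 (ltW r0)); apply: upper_integral_leP => [s|].
      exact: powR_ge0.
    have := upper_integral_leZ (powR_ge0 r q) xp; rewrite mulr1.
    apply: upper_integral_leS => s; rewrite /= norm_radial// powRM ?powR_ge0 ?(ltW r0)//.
    by rewrite -powRrM divfK ?gt_eqF.
  by split => //; split => //; exact: le_lt_trans yr (ltry _).
have k0 : 0 <= `|p / q - 1| * (r / c) by rewrite mulr_ge0// divr_ge0// ltW.
rewrite mulrA; apply: upper_integral_leS (upper_integral_leZ k0
  (upper_integral_leD upper_integral_le_cst1 xp)) => s /=.
rewrite radial_dist//.
rewrite [leRHS](_ : _ = r * (`|p / q - 1| / c * (1 + (`|x s| / r) `^ p))); last by ring.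
by rewrite ler_pM2l//; apply: powR_dist_le => //; rewrite divr_ge0// ltW.
Qed.

End BallTransfer.

Lemma Lp_ball0 {R : realType} {d : measure_display} {T : measurableType d}
  {V : normedModType R} (mu : {finite_measure set T -> \bar R}) (p r : R) :
  0 < p -> 0 <= r -> Lp_ball mu p r (fun=> 0 : V).
Proof.
move=> p0 r0.
have N0 : (Bnorm mu p (fun=> 0%R : V) <= r%:E)%E.
  rewrite (Bnorm_leP mu _ p0 r0).
  under eq_integral do rewrite normr0 powR0 ?gt_eqF//.
  by rewrite integral0 lee_fin powR_ge0.
split => //; split; last exact: le_lt_trans N0 (ltry _).
by apply: is_simple_strongly_measurable; exact: is_simple_cst.
Qed.

(** * Convergence of the Hausdorff distance *)

Lemma cvg_div_dnbhs {R : realType} (q : R) : q != 0 ->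
  (p / q) @[p --> q^'] --> (1 : R) /\
  (q / p) @[p --> q^'] --> (1 : R).
Proof.
move=> q0; have pq : p @[p --> q^'] --> q by exact: cvg_within.
rewrite -(divff q0); split; first exact: cvgMr_tmp.
by apply: cvgMl_tmp; exact: cvgV.
Qed.

Theorem theorem6p1 (R : realType) (X Y : completeNormedModType R)
  (sepX : separable X) (sepY : separable Y)
  (d0 d : measure_display)
  (Omega0 : measurableType d0) (Omega : measurableType d)
  (mu0 : {finite_measure set Omega0 -> \bar R})
  (mu : {finite_measure set Omega -> \bar R})
  (r : R) (r_gt0 : 0 < r)
  (K : Omega0 -> Omega -> X -> Y)
  (K_meas : forall x : X,
     strongly_measurable (mu0 \x mu)%E
       (fun z : Omega0 * Omega => K z.1 z.2 x))
  (K0_L1 : Lp (mu0 \x mu)%E 1 (fun z : Omega0 * Omega => K z.1 z.2 0))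
  (K_Lip : exists psi : Omega0 -> Omega -> R,
     [/\ forall xi s, 0 <= psi xi s,
         {ae mu0, forall xi, Linfty_nonneg mu (psi xi)},
         Lp mu0 1 ((fun xi => fine (norm_infty mu (psi xi))) : Omega0 -> R^o) &
         {ae (mu0 \x mu)%E, forall z : Omega0 * Omega, forall x1 x2 : X,
            `|K z.1 z.2 x1 - K z.1 z.2 x2| <= psi z.1 z.2 * `|x1 - x2|}])
  (pstar : R) (pstar_gt1 : 1 < pstar) :
  Hausdorff_L1 mu0 (Urysohn_image mu K p r) (Urysohn_image mu K pstar r)
    @[p --> pstar^'] --> 0%E.
Proof.
have [psi [_ psiL /Lp1_upper_integral_le[C phiC] KL]] := K_Lip.
have {}phiC : upper_integral_le mu0 (fun xi => fine (norm_infty mu (psi xi))) C.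
  by apply: upper_integral_leS phiC => xi; exact: ler_norm.
(* The strict inequalities c < 1 and 1 + c < pstar make the conditions of [Lp_ball_transfer] hold
   for p near pstar, in both directions: the ratios tend to 1, and p - p / pstar tends to pstar -
   1. *)
pose c : R := Num.min (1 / 2) ((pstar - 1) / 2).
have c0 : 0 < c by rewrite lt_min divr_gt0//= divr_gt0// subr_gt0.
have c1 : c < 1 by rewrite gt_min; apply/orP; left; lra.
have cp : 1 + c < pstar.
  have : c <= (pstar - 1) / 2 by rewrite ge_min lexx orbT.
  by move: pstar_gt1; lra.
pose M := C * (r / c * (fine (mu setT) + 1)).
have sup_le p q : 0 < p -> 1 <= q -> 1 <= p -> c <= p / q -> 1 + c <= p ->
    p / q + c <= p ->
    (ereal_sup [set dist_L1 mu0 y (Urysohn_image mu K q r) |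
       y in Urysohn_image mu K p r] <= (`|p / q - 1| * M)%:E)%E.
  move=> p0 q1 p1 cpq c1p pqc; apply: ge_ereal_sup => _ [_ [x xB <-] <-].
  have q0 : 0 < q by exact: lt_le_trans q1.
  have [y [yB xy]] := Lp_ball_transfer p0 q0 r_gt0 c0 (ltW c1) cpq c1p pqc xB.
  apply: (@le_trans _ _ (Bnorm mu0 1 (fun xi => Urysohn mu K x xi - Urysohn mu K y xi))).
    by apply: ereal_inf_lbound; exists (Urysohn mu K y) => //; exists y.
  have := Urysohn_dist K_meas K0_L1 psiL KL phiC (Lp_ball_L1_approx p1 r_gt0 xB)
    (Lp_ball_L1_approx q1 r_gt0 yB) xy.
  by rewrite mulrCA.
(* The supremum of an empty set would be -oo; the image of the zero function rules this out. *)
have sup_ge p q : 0 < p ->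
    (0 <= ereal_sup [set dist_L1 mu0 y (Urysohn_image mu K q r) |
       y in Urysohn_image mu K p r])%E.
  move=> p0; apply: le_ereal_sup_tmp.
  exists (dist_L1 mu0 (Urysohn mu K (fun=> 0)) (Urysohn_image mu K q r)).
    exists (Urysohn mu K (fun=> 0)) => //; exists (fun=> 0) => //.
    by apply: Lp_ball0 => //; exact: ltW.
  by apply: le_ereal_inf_tmp => _ [w _ <-]; exact: Lnorm_ge0.
have pstar0 : 0 < pstar by apply: lt_trans pstar_gt1.
have [cvg1 cvg2] := cvg_div_dnbhs (lt0r_neq0 pstar0).
have idp : p @[p --> pstar^'] --> pstar by exact: cvg_within.
apply: (@squeeze_cvge _ _ _ _ (cst 0%E) _
  (fun p => (`|p / pstar - 1| * M + `|pstar / p - 1| * M)%:E)).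
- near=> p.
  have p1c : 1 + c <= p by near: p; exact: (cvgr_ge _ idp).
  have p1 : 1 <= p by apply: le_trans p1c; rewrite lerDl ltW.
  have p0 : 0 < p by exact: lt_le_trans p1.
  have cpq : c <= p / pstar by near: p; exact: (cvgr_ge _ cvg1).
  have cqp : c <= pstar / p by near: p; exact: (cvgr_ge _ cvg2).
  have le1 : p / pstar + c <= p.
    near: p.
    have cp' : c < pstar - 1 by rewrite ltrBrDl.
    apply: filterS (cvgr_ge _ (cvgB idp cvg1) c cp') => p.
    by rewrite lerBrDl.
  have le2 : pstar / p + c <= pstar.
    rewrite -lerBrDr; near: p; apply: (cvgr_le _ cvg2).
    by rewrite ltrBrDr.
  have pstar1 := ltW pstar_gt1.
  rewrite /Hausdorff_L1; apply/andP; split.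
    by rewrite le_max sup_ge.
  have M1 := sup_le p pstar p0 pstar1 p1 cpq p1c le1.
  have M2 := sup_le pstar p pstar0 p1 pstar1 cqp (ltW cp) le2.
  (* Each bound dominates a nonnegative supremum and is thus nonnegative, which lets the maximum be
     estimated by the sum. *)
  have ge1 := le_trans (sup_ge p pstar p0) M1.
  have ge2 := le_trans (sup_ge pstar p pstar0) M2.
  rewrite ge_max EFinD; apply/andP; split.
    by apply: (le_trans M1); rewrite leeDl.
  by apply: (le_trans M2); rewrite leeDr.
- exact: cvg_cst.
- apply: cvg_EFin; first exact: nearW.
  rewrite [X in _ --> X](_ : _ = `|1 - 1| * M + `|1 - 1| * M); last first.
    by rewrite subrr normr0 mul0r addr0.
  by apply: cvgD; apply: cvgMr_tmp; apply: cvg_norm; apply: cvgB => //; exact: cvg_cst.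
Unshelve. all: by end_near. Qed.
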